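(* Let $X$ and $Y$ be metric spaces and let $f\colon X\to Y$ be a quasihomogeneous map from $X$ onto $Y$. If $X$ has the Lipschitz Clustering Property, then $Y$ has the Lipschitz Clustering Property as well.
   Context: A homeomorphism $f$ of $X$ onto $Y$ is quasihomogeneous if there exists a homeomorphism $\eta\colon[0,\infty)\to[0,\infty)$ such that for any four distinct points $x_1,\dots,x_4$ in $X$, with $y_k=f(x_k)$, we have $\frac{d_Y(y_1,y_2)}{d_Y(y_3,y_4)}\le \eta\left(\frac{d_X(x_1,x_2)}{d_X(x_3,x_4)}\right)$. For a metric space $(X,d)$ and a positive integer $n$, $X(n)=\{A\subset X\colon 1\le |A|\le n\}$, equipped with the Hausdorff metric $\Delta(A,B)=\max\left(\sup_{a\in A}\operatorname{dist}(a,B),\ \sup_{b\in B}\operatorname{dist}(b,A)\right)$; $X(n-1)\subset X(n)$. $X$ has the Lipschitz Clustering Property (LCP) if for every integer $n\ge 2$ there exists a Lipschitz map $X(n)\to X(n-1)$ whose restriction to $X(n-1)$ is the identity (a Lipschitz retraction). *)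

(* Defs.v *)
From HB Require Import structures.
From mathcomp Require Import all_boot all_order all_algebra.
From mathcomp Require Import all_classical all_reals all_analysis.

Set Implicit Arguments.
Unset Strict Implicit.
Unset Printing Implicit Defensive.

Import Order.TTheory GRing.Theory Num.Theory.
Import numFieldNormedType.Exports.

Local Open Scope classical_set_scope.
Local Open Scope card_scope.
Local Open Scope ring_scope.

(* [f] restricts to a homeomorphism of [A] onto [B], both with the subspace
   topology; the values of [f] and [g] outside [A] and [B] are irrelevant. *)
Definition homeomorphism (T U : topologicalType) (A : set T) (B : set U)
    (f : T -> U) : Prop :=
  exists g : U -> T,
    [/\ set_fun A B f, set_fun B A g, {in A, cancel f g} & {in B, cancel g f}] /\
    {within A, continuous f} /\ {within B, continuous g}.

Definition quasihomogeneous (R : realType) (X Y : metricType R)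
    (f : X -> Y) : Prop :=
  homeomorphism [set: X] [set: Y] f /\
  exists2 eta : R -> R,
    homeomorphism (`[0, +oo[ : set R) (`[0, +oo[ : set R) eta &
    forall x1 x2 x3 x4 : X, uniq [:: x1; x2; x3; x4] ->
      mdist (f x1) (f x2) / mdist (f x3) (f x4)
        <= eta (mdist x1 x2 / mdist x3 x4).

(* The space X(n) of nonempty subsets of X with at most n elements. *)
Definition finite_subsets (X : Type) (n : nat) : set (set X) :=
  [set A | A !=set0 /\ A #<= `I_n].
Arguments finite_subsets : clear implicits.

Definition dist_to_set (R : realType) (X : metricType R) (x : X)
    (A : set X) : R :=
  inf [set mdist x a | a in A].

(* For the nonempty finite sets considered here the infima and suprema are
   those of nonempty bounded sets, hence the default values of [inf] and [sup]
   are never used. *)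
Definition hausdorff_dist (R : realType) (X : metricType R)
    (A B : set X) : R :=
  Num.max (sup [set dist_to_set a B | a in A])
          (sup [set dist_to_set b A | b in B]).

(* Only the values of [r] on X(n) matter. *)
Definition lipschitz_retraction (R : realType) (X : metricType R) (n : nat)
    (r : set X -> set X) : Prop :=
  [/\ set_fun (finite_subsets X n) (finite_subsets X n.-1) r,
      exists2 L : R, 0 <= L &
        forall A B : set X, finite_subsets X n A -> finite_subsets X n B ->
          hausdorff_dist (r A) (r B) <= L * hausdorff_dist A B
    & forall A : set X, finite_subsets X n.-1 A -> r A = A].

Definition lipschitz_clustering (R : realType) (X : metricType R) : Prop :=
  forall n : nat, (2 <= n)%N ->
    exists r : set X -> set X, lipschitz_retraction n r.

(* Main.v *)
(* Write E for the metric of Y and D for the metric of X carried over to Y by f.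
   The obvious candidate f r f^-1, with r a Lipschitz retraction of X(n), need
   not be Lipschitz: quasihomogeneity compares E p q with E a b only for four
   distinct points, and E a q can be huge compared with E a b although D a q is
   at most a constant times D a b.  In that case, however, every pair of points
   whose E-distance is comparable to E a b, in particular {a, b}, consists of
   mutual nearest neighbours (gap_isolated).  Call such a pair {a, b} a twin
   pair; outside twin pairs E is controlled by D without exception.

   Given a set A of exactly n points, if its closest points are twins then one
   of them is dropped; sets Hausdorff-close to A have the same closest points,
   so the choice can be made consistently.  Otherwise collapse the twin pairs
   that are not contained in A to one of their points, apply r, and move back
   to the points of A within each twin pair.  Both rules move A by at most a
   constant times its minimal distance, so the Lipschitz estimate is only needed
   for sets of n points whose Hausdorff distance is small compared with their
   minimal distances. *)

Require Import Defs.
From mathcomp Require Import all_boot all_order all_algebra.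
From mathcomp Require Import all_classical all_reals all_analysis.
From mathcomp Require Import finmap lra.

Set Implicit Arguments.
Unset Strict Implicit.
Unset Printing Implicit Defensive.

Import Order.TTheory GRing.Theory Num.Theory.
Import numFieldNormedType.Exports.

Local Open Scope classical_set_scope.
Local Open Scope card_scope.
Local Open Scope ring_scope.

(** * Finite sets and Hausdorff distance *)

Lemma finite_argmax (R : realDomainType) (T : eqType) (A : set T) (h : T -> R) :
  finite_set A -> A !=set0 -> exists2 x, A x & forall y, A y -> h y <= h x.
Proof.
move=> /finite_seqP[s ->]; elim: s => [|a s IH] [x0]; first by [].
move=> _; case: s IH => [_|b s IH].
  by exists a => [|y] /=; rewrite ?mem_seq1 ?inE// => /eqP ->.
have [|x xs hx] := IH; first by exists b; rewrite /= mem_head.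
case: (lerP (h a) (h x)) => [hax|/ltW hxa].
  exists x => [/=|y /=]; first by rewrite in_cons [_ \in _]xs orbT.
  by rewrite in_cons => /orP[/eqP ->//|]; exact: hx.
exists a => [/=|y /=]; first by rewrite mem_head.
by rewrite in_cons => /orP[/eqP ->//|/hx /le_trans]; exact.
Qed.

Lemma finite_argmin (R : realDomainType) (T : eqType) (A : set T) (h : T -> R) :
  finite_set A -> A !=set0 -> exists2 x, A x & forall y, A y -> h x <= h y.
Proof.
move=> fA A0; have [x Ax hx] := finite_argmax (fun x => - h x) fA A0.
by exists x => // y /hx; rewrite lerN2.
Qed.

Lemma card_le_II_fset (T : choiceType) (A : set T) (n : nat) :
  finite_set A -> (A #<= `I_n) = (#|` fset_set A| <= n)%N.
Proof.
move=> /finite_setP[m Am].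
by rewrite (card_le_eql Am) card_le_II (card_fset_set Am).
Qed.

Lemma card_le_setD1 (T : choiceType) (A : set T) (u : T) (n : nat) :
  A #<= `I_n -> A u -> A `\ u #<= `I_n.-1.
Proof.
move=> An Au.
have fA : finite_set A by apply/finite_set_leP; exists n.
move: An; rewrite !card_le_II_fset//; last exact: finite_setD.
rewrite fset_setD1// (cardfsD1 u (fset_set A)) in_fset_set// mem_set//=.
by case: n.
Qed.

(** Pigeonhole: if [b] were missed, the image of [A], equinumerous with [A], would lie in [B]
    without [b] and have at most [n - 1] elements. *)
Lemma inj_surj_II (T U : choiceType) (A : set T) (B : set U) (m : T -> U)
    (n : nat) :
  ~ (A #<= `I_n.-1) -> B #<= `I_n -> (forall a, A a -> B (m a)) ->
  (forall a a', A a -> A a' -> m a = m a' -> a = a') ->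
  forall b, B b -> exists2 a, A a & m a = b.
Proof.
move=> nA Bn mAB minj b Bb; apply: contrapT => nb; apply: nA.
have mA : m @` A #= A.
  apply: inj_card_eq => x y xA yA. exact: minj (set_mem xA) (set_mem yA).
rewrite -(card_le_eql mA); apply: card_le_trans (card_le_setD1 Bn Bb).
apply: subset_card_le => _ [a Aa <-]; split; first exact: mAB.
by move=> mab; apply: nb; exists a.
Qed.

(** The first argument of [xget] is only a default for the empty set, so the choices below depend on
    the set alone. *)
Lemma xget_default (T : choiceType) (P : set T) (u x y : T) :
  P u -> xget x P = xget y P.
Proof.
move=> Pu; rewrite /xget; case: pselect => // -[].
by exists u; exact: asboolT.
Qed.

Section metrics.
Variables (R : realType) (T : choiceType).
Implicit Types (d : T -> T -> R) (A B C : set T).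

(** A predicate on functions, because two metrics on the same type are compared. *)
Definition is_metric d :=
  [/\ forall x, d x x = 0, forall x y, x != y -> 0 < d x y,
      forall x y, d x y = d y x & forall x y z, d x z <= d x y + d y z].

(** For nonempty finite sets this bounds the Hausdorff distance by [t] without infima and suprema;
    see [hausdorff_dist_le]. *)
Definition hclose d A B (t : R) :=
  (forall a, A a -> exists2 b, B b & d a b <= t) /\
  (forall b, B b -> exists2 a, A a & d a b <= t).

Lemma is_metric_ge0 d x y : is_metric d -> 0 <= d x y.
Proof.
by case=> d0 dp _ _; have [->|/dp/ltW//] := eqVneq x y; rewrite d0.
Qed.

Lemma hclose_refl d A : is_metric d -> hclose d A A 0.
Proof. by case=> d0 _ _ _; split=> a Aa; exists a; rewrite ?d0. Qed.

Lemma hclose_sym d A B t : is_metric d -> hclose d A B t -> hclose d B A t.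
Proof.
move=> [_ _ ds _] [AB BA]; split=> [b /BA[a Aa]|a /AB[b Bb]] ab.
  by exists a; rewrite 1?ds.
by exists b; rewrite 1?ds.
Qed.

Lemma hclose_trans d A B C s t : is_metric d ->
  hclose d A B s -> hclose d B C t -> hclose d A C (s + t).
Proof.
move=> [_ _ _ dt] [AB BA] [BC CB]; split.
  move=> a /AB[b /BC[c Cc bc] ab]; exists c => //.
  by apply: le_trans (dt _ b _) _; exact: lerD.
move=> c /CB[b /BA[a Aa ab] bc]; exists a => //.
by apply: le_trans (dt _ b _) _; exact: lerD.
Qed.

Lemma hclose_le d A B s t : s <= t -> hclose d A B s -> hclose d A B t.
Proof.
move=> st [AB BA]; split=> [a /AB[b Bb ab]|b /BA[a Aa ab]].
  by exists b => //; exact: le_trans st.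
by exists a => //; exact: le_trans st.
Qed.

Lemma hclose_setD1 d A u v : is_metric d -> A u -> A v -> u != v ->
  hclose d A (A `\ u) (d u v).
Proof.
move=> dm; have [d0 _ _ _] := dm; move=> Au Av uv; split=> [a Aa|b [Ab _]].
  have [->|au] := eqVneq a u.
    by exists v => //; split=> //= vu; rewrite vu eqxx in uv.
  by exists a; [split=> //= e; rewrite e eqxx in au|rewrite d0 is_metric_ge0].
by exists b; rewrite // d0 is_metric_ge0.
Qed.

Definition lret d (n : nat) (r : set T -> set T) :=
  [/\ set_fun (finite_subsets T n) (finite_subsets T n.-1) r,
      exists2 L : R, 1 <= L & forall A B t,
        finite_subsets T n A -> finite_subsets T n B ->
        hclose d A B t -> hclose d (r A) (r B) (L * t)
    & forall A, finite_subsets T n.-1 A -> r A = A].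

Lemma finite_subsets_le n A : finite_subsets T n.-1 A -> finite_subsets T n A.
Proof.
move=> [A0 An]; split => //; apply: card_le_trans An _.
by rewrite card_le_II leq_pred.
Qed.

Lemma finite_subsets_finite n A : finite_subsets T n A -> finite_set A.
Proof. by move=> [_ An]; apply/finite_set_leP; exists n. Qed.

Lemma finite_subsets_image (U : choiceType) n A (h : T -> U) :
  finite_subsets T n A -> finite_subsets U n (h @` A).
Proof.
move=> [[a Aa] An]; split; first by exists (h a); exists a.
exact: card_le_trans (card_image_le _ _) An.
Qed.

Lemma finite_subsets_setD1 n A u v : finite_subsets T n A -> A u -> A v ->
  u != v -> finite_subsets T n.-1 (A `\ u).
Proof.
move=> [_ An] Au Av uv; split; last exact: card_le_setD1.
by exists v; split=> //= vu; rewrite vu eqxx in uv.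
Qed.

Lemma exists_two n A : (2 <= n)%N -> finite_subsets T n A ->
  ~ finite_subsets T n.-1 A -> exists u v, [/\ A u, A v & u != v].
Proof.
move=> n2 [[a Aa] An] nA; apply: contrapT => nuv; apply: nA.
split; first by exists a.
have Aa1 : A `<=` [set a].
  move=> x Ax; apply: contrapT => xa; apply: nuv; exists x, a; split=> //.
  exact/eqP.
apply: card_le_trans (subset_card_le Aa1) _.
by rewrite (card_le_eql card_set1) card_le_II; case: n n2 {An} => [|[]].
Qed.

Definition spaced d A (t : R) :=
  forall x y, A x -> A y -> x != y -> t < d x y.

(** Two points of [A] with a common partner in [B] would be at most [2 * t] apart, so the matching
    is injective and, by counting, onto. Distances drop by at most [2 * t] along it. *)
Lemma hclose_spaced d n A B t e : is_metric d ->
  finite_subsets T n A -> ~ finite_subsets T n.-1 A -> finite_subsets T n B ->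
  hclose d A B t -> spaced d A (e + 2 * t) -> 0 <= e ->
  ~ finite_subsets T n.-1 B /\ spaced d B e.
Proof.
move=> dm [A0 An] nA [B0 Bn] [AB BA] sA e0; have [d0 dp ds dt] := dm.
have /choice[m mP] : forall a, exists b, A a -> B b /\ d a b <= t.
  move=> a; have [/AB[b Bb ab]|nAa] := pselect (A a); first by exists b.
  by exists a.
have minj a a' : A a -> A a' -> m a = m a' -> a = a'.
  move=> Aa Aa' mm; apply/eqP; apply/negPn/negP => /(sA _ _ Aa Aa').
  have [_ h1] := mP _ Aa; have [_ h2] := mP _ Aa'.
  have := dt a (m a) a'; rewrite {2}mm (ds (m a')); lra.
have nAn : ~ (A #<= `I_n.-1) by move=> An1; apply: nA.
have onto := inj_surj_II nAn Bn (fun a Aa => (mP a Aa).1) minj.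
split.
  move=> [_ Bn1]; apply: nAn; apply: card_le_trans Bn1.
  have mA : m @` A #= A.
    apply: inj_card_eq => x y xA yA.
    exact: minj (set_mem xA) (set_mem yA).
  rewrite -(card_le_eql mA); apply: subset_card_le => _ [a Aa <-].
  by have [] := mP _ Aa.
move=> x y /onto[a Aa <-] /onto[b Ab <-] mab.
have ab : a != b by apply: contra_neq mab => ->.
have := sA _ _ Aa Ab ab.
have [_ h1] := mP _ Aa; have [_ h2] := mP _ Ab.
have := dt a (m a) b; have := dt (m a) (m b) b; rewrite (ds (m b)); lra.
Qed.

End metrics.

Ltac solve_uniq := rewrite /= !inE !negb_or !andbT;
  repeat (apply/andP; split); by rewrite // eq_sym.

(** * Twin pairs *)

Section twins.
Variables (R : realType) (T : choiceType) (E : T -> T -> R).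
Hypothesis Em : is_metric E.

Let E0 x : E x x = 0. Proof. by case: Em. Qed.
Let Ep x y : x != y -> 0 < E x y. Proof. by case: Em => _ + _ _; exact. Qed.
Let Es x y : E x y = E y x. Proof. by case: Em. Qed.
Let Et y x z : E x z <= E x y + E y z. Proof. by case: Em => _ _ _; exact. Qed.

Definition mutual_nearest p q :=
  forall w, w != p -> w != q -> E p q < E p w /\ E p q < E q w.

(** The condition concerns the length [t] only, so pairs of equal length are twins together; the
    window leaves room for the slightly shorter closest pairs of a Hausdorff-close set. *)
Definition isolated_scale (t : R) :=
  forall p q, p != q -> t / 2 <= E p q -> E p q <= 2 * t -> mutual_nearest p q.

Definition twin a b := a != b /\ isolated_scale (E a b).

(** * Comparison of the two metrics outside twin pairs *)

Section comparison.
Variable D : T -> T -> R.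
Hypothesis Dm : is_metric D.
(** Both hypotheses come from quasihomogeneity: this one because [eta] is at most [eta M] up to [M],
    the next because [eta] is below 1/2 near 0. *)
Hypothesis E_of_D : forall M, 0 <= M -> exists2 K, 0 < K &
  forall x1 x2 x3 x4, uniq [:: x1; x2; x3; x4] ->
    D x1 x2 <= M * D x3 x4 -> E x1 x2 <= K * E x3 x4.
Hypothesis D_of_E : exists2 C, 0 < C &
  forall x1 x2 x3 x4, uniq [:: x1; x2; x3; x4] ->
    E x3 x4 <= 2 * E x1 x2 -> D x3 x4 <= C * D x1 x2.

Let Dp x y : x != y -> 0 < D x y. Proof. by case: Dm => _ + _ _; exact. Qed.
Let Ds x y : D x y = D y x. Proof. by case: Dm. Qed.
Let Dt y x z : D x z <= D x y + D y z. Proof. by case: Dm => _ _ _; exact. Qed.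

(** If [w] were E-near to [a], then [w q] would be E-long, hence D-long, and so would be [w b], as
    [q] is D-near to [b]. Comparing [a q] with [w b] would then bound [E a q] by a multiple of
    [E a b]. *)
Lemma gap_far (L : R) : 1 <= L -> exists2 K, 0 < K &
  forall a b q w, a != b -> q != a -> q != b -> w != a -> w != b ->
    D a q <= L * D a b -> K * E a b < E a q ->
    3 * E a b < E a w /\ 2 * E a b < E b w.
Proof.
move=> L1.
have [K1 K1_gt0 K1P] := @E_of_D 1 ler01.
(* Since [D q b] is at most [(L + 1) * D a b], the factor [2 * L + 2] leaves [D w b] at least
   [D a q]. *)
have [|K2 K2_gt0 K2P] := @E_of_D (2 * L + 2); first lra.
exists (3 + K2 + 4 * K1); first lra.
move=> a b q w ab qa qb wa wb Daq Eaq.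
have b0 := Ep ab.
suff aw : 3 * E a b < E a w.
  by split=> //; have := Et b a w; lra.
rewrite ltNge; apply/negP => aw.
have K2b : 0 < K2 * E a b by exact: mulr_gt0.
have K1b : 0 < K1 * E a b by exact: mulr_gt0.
have wq : w != q by apply/eqP => wq; move: aw Eaq; rewrite wq; lra.
have Ewq : K2 * E a b < E w q by have := Et w a q; lra.
have Dwq : (2 * L + 2) * D a b < D w q.
  rewrite ltNge; apply/negP => /K2P; rewrite leNgt Ewq => /(_ _)/negP[]//.
  by solve_uniq.
have Dwb : D a q <= 1 * D w b.
  have := Dp ab; have := Dt b w q; have := Dt a b q; rewrite (Ds b a); lra.
have : E a q <= K1 * E w b by apply: K1P => //; solve_uniq.
have : K1 * E w b <= K1 * (4 * E a b).
  by rewrite ler_pM2l//; have := Et a w b; rewrite (Es w a); lra.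
lra.
Qed.

(** At the scale of [E a b], [gap_far] excludes pairs with exactly one of [a], [b], and [disj]
    excludes pairs avoiding [a], [b], [q]. Pairs of [q] with a further point are mutual nearest
    neighbours by [star]. *)
Lemma gap_isolated (L : R) : 1 <= L -> exists2 K, 0 < K &
  forall a b q, a != b -> q != a -> q != b ->
    D a q <= L * D a b -> K * E a b < E a q -> twin a b.
Proof.
move=> L1.
have [K0 K0_gt0 far] := gap_far L1.
have [C C_gt0 CP] := D_of_E.
(* The summand [L * C] serves [disj], the summand [C * C * (L + 1)] serves [star]. *)
pose M := C * C * (L + 1) + L * C.
have CC : 0 < C * C by exact: mulr_gt0.
have LC : 0 < L * C by apply: mulr_gt0 => //; lra.
have CCL : 0 < C * C * (L + 1) by apply: mulr_gt0 => //; lra.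
have [|K1 K1_gt0 K1P] := @E_of_D M; first by rewrite /M; lra.
exists (K0 + 2 * K1 + 6); first lra.
move=> a b q ab qa qb Daq Eaq.
have b0 := Ep ab; have D0 := Dp ab.
have K0b : 0 < K0 * E a b by exact: mulr_gt0.
have K1b : 0 < K1 * E a b by exact: mulr_gt0.
have {}far w : w != a -> w != b -> 3 * E a b < E a w /\ 2 * E a b < E b w.
  by move=> wa wb; apply: far Daq _ => //; lra.
(* Such a pair satisfies [D a b <= C * D p p'], so [D a q] is at most [L * C * D p p'], which would
   make [E a q] comparable to [E p p']. *)
have disj p p' : uniq [:: a; q; p; p'] -> p != b -> p' != b ->
    E a b / 2 <= E p p' -> E p p' <= 2 * E a b -> False.
  move=> u pb p'b h1 h2.
  have Daq' : M * D p p' < D a q.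
    rewrite ltNge; apply/negP => /(K1P _ _ _ _ u).
    have : K1 * E p p' <= K1 * (2 * E a b) by rewrite ler_pM2l.
    lra.
  have Dab : D a b <= C * D p p'.
    apply: CP; last lra.
    move: u; rewrite /= !inE !negb_or !andbT.
    move=> /and3P[/and3P[? ? ?] /andP[? ?] ?].
    by repeat (apply/andP; split); rewrite // eq_sym.
  have pp : 0 < D p p'.
    by apply: Dp; move: u; rewrite /= !inE !andbT => /and3P[].
  have : L * D a b <= L * (C * D p p') by rewrite ler_pM2l//; lra.
  have : 0 < C * C * (L + 1) * D p p' by exact: mulr_gt0.
  by move: Daq'; rewrite /M mulrDl mulrA; lra.
(* [E z a] is huge against [E q w], so [D z a] exceeds [M * D q w]; yet [D z a] is controlled by
   [D q b], hence by [D a b], hence by [D q w]. The bound [4 * E a b] covers [z] near [q] as well as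
   [z] near [w]. *)
have star w z : w != a -> w != b -> w != q -> z != a -> z != b -> z != q ->
    z != w -> E a b / 2 <= E q w -> E q w <= 2 * E a b -> E q z <= 4 * E a b ->
    False.
  move=> wa wb wq za zb zq zw h1 h2 h3.
  have Eza : K1 * E q w < E z a.
    have : K1 * E q w <= K1 * (2 * E a b) by rewrite ler_pM2l.
    have := Et z a q; rewrite (Es z q) (Es z a); lra.
  have Dza : M * D q w < D z a.
    rewrite ltNge; apply/negP => /K1P; rewrite leNgt Eza => /(_ _)/negP[]//.
    by solve_uniq.
  have Dab : D a b <= C * D q w by apply: CP; [solve_uniq|lra].
  have Dzaqb : D z a <= C * D q b.
    apply: CP; first by solve_uniq.
    have := Et q z a; have := Et b q a; have := Et q a b.
    rewrite (Es z q) (Es b a) (Es q a); have := Et b a q; rewrite (Es b q); lra.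
  have Dqb : D q b <= (L + 1) * D a b.
    by have := Dt a q b; rewrite (Ds q a); lra.
  have : C * D q b <= C * ((L + 1) * D a b) by rewrite ler_pM2l.
  have : C * (L + 1) * D a b <= C * (L + 1) * (C * D q w).
    by rewrite ler_pM2l//; apply: mulr_gt0 => //; lra.
  have qw : 0 < L * C * D q w.
    by apply: mulr_gt0 => //; apply: Dp; rewrite eq_sym.
  by move: Dza; rewrite /M; nra.
split=> // p p' pp' h1 h2.
have Eqb : 5 * E a b < E q b by have := Et b a q; rewrite (Es b q); lra.
have mnq w : w != a -> w != b -> w != q -> E a b / 2 <= E q w ->
    E q w <= 2 * E a b -> mutual_nearest q w.
  move=> wa wb wq g1 g2 z zq zw.
  have [->|za] := eqVneq z a.
    split; have := Et w a q; have := Es w a; have := Es w q;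
      have := Es q a; lra.
  have [->|zb] := eqVneq z b.
    by split; have := Et w q b; lra.
  split; rewrite ltNge; apply/negP => g; apply: (star w z) => //; first lra.
  by have := Et w q z; lra.
have mns x y : mutual_nearest x y -> mutual_nearest y x.
  by move=> h w wy wx; have [] := h _ wx wy; rewrite (Es x).
have mnab : mutual_nearest a b.
  by move=> z za zb; have [? ?] := far z za zb; split; lra.
have [pa|pa] := eqVneq p a; [|have [pb|pb] := eqVneq p b];
  [| |have [p'a|p'a] := eqVneq p' a; [|have [p'b|p'b] := eqVneq p' b]].
- subst p; have [->//|p'b] := eqVneq p' b.
  have p'a : p' != a by rewrite eq_sym.
  by exfalso; have [] := far p' p'a p'b; lra.
- subst p; have [->|p'a] := eqVneq p' a; first exact: mns.
  have p'b : p' != b by rewrite eq_sym.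
  by exfalso; have [] := far p' p'a p'b; lra.
- by subst p'; exfalso; have [] := far p => //; have := Es a p; lra.
- by subst p'; exfalso; have [] := far p => //; have := Es b p; lra.
- have [pq|pq] := eqVneq p q.
    by subst p; have p'q : p' != q; [rewrite eq_sym|exact: mnq].
  have [p'q|p'q] := eqVneq p' q.
    by subst p'; apply: mns; apply: mnq; rewrite // (Es q).
  by exfalso; apply: (disj p p') => //; solve_uniq.
Qed.

(** Pairs disjoint from [a], [b] are covered by [E_of_D]; a pair sharing one point and violating the
    bound would make [a], [b] twins by [gap_isolated]. *)
Lemma nontwin_comparable (L : R) : 1 <= L -> exists2 K, 1 <= K &
  forall a b p q, a != b -> ~ twin a b ->
    D p q <= L * D a b -> E p q <= K * E a b.
Proof.
move=> L1.
have [K0 K0_gt0 gap] := gap_isolated L1.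
have [|K1 K1_gt0 K1P] := @E_of_D L; first lra.
exists (1 + K0 + K1); first lra.
have share a b q : a != b -> ~ twin a b -> q != a -> q != b ->
    D a q <= L * D a b -> E a q <= (1 + K0 + K1) * E a b.
  move=> ab nab qa qb Daq; have b0 := Ep ab.
  have K1b : 0 < K1 * E a b by exact: mulr_gt0.
  have : E a q <= K0 * E a b.
    by rewrite leNgt; apply/negP => /(gap _ _ _ ab qa qb Daq).
  lra.
have twin_sym a b : twin a b -> twin b a.
  by move=> [ab i]; split; rewrite 1?eq_sym// Es.
move=> a b p q ab nab Dpq; have b0 := Ep ab.
have K0b : 0 < K0 * E a b by exact: mulr_gt0.
have K1b : 0 < K1 * E a b by exact: mulr_gt0.
have ba : b != a by rewrite eq_sym.
have nba : ~ twin b a by move=> /twin_sym.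
have [->|pq] := eqVneq p q; first by rewrite E0; lra.
have [pa|pa] := eqVneq p a.
  subst p; have [->|qb] := eqVneq q b; first by lra.
  by apply: share => //; rewrite eq_sym.
have [pb|pb] := eqVneq p b.
  subst p; have [->|qa] := eqVneq q a; first by rewrite (Es b); lra.
  have qb : q != b by rewrite eq_sym.
  by rewrite (Es a b); apply: share; rewrite // (Ds b a).
have [qa|qa] := eqVneq q a.
  by subst q; rewrite Es; apply: share => //; rewrite Ds.
have [qb|qb] := eqVneq q b.
  by subst q; rewrite Es (Es a); apply: share => //; rewrite Ds (Ds b).
suff : E p q <= K1 * E a b by lra.
by apply: K1P => //; solve_uniq.
Qed.

End comparison.

End twins.

(** * Twin classes, collapsing and restoring *)

Section twin_theory.
Variables (R : realType) (T : choiceType) (E : T -> T -> R).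
Hypothesis Em : is_metric E.

Let E0 x : E x x = 0. Proof. by case: Em. Qed.
Let Ep x y : x != y -> 0 < E x y. Proof. by case: Em => _ + _ _; exact. Qed.
Let Es x y : E x y = E y x. Proof. by case: Em. Qed.
Let Et y x z : E x z <= E x y + E y z. Proof. by case: Em => _ _ _; exact. Qed.

Lemma twin_sym a b : twin E a b -> twin E b a.
Proof. by move=> [ab i]; split; rewrite 1?eq_sym// Es. Qed.

Lemma twin_nearest a b w : twin E a b -> w != a -> w != b -> E a b < E a w.
Proof.
move=> [ab i] wa wb; have b0 := Ep ab.
have [||//] := i a b ab _ _ w wa wb; lra.
Qed.

(** Of two different twins of [a], each would be strictly nearer to [a] than the other. *)
Lemma twin_unique a b c : twin E a b -> twin E a c -> b = c.
Proof.
move=> ab ac; apply/eqP/negPn/negP => bc.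
have [ab' _] := ab; have [ac' _] := ac.
have := twin_nearest ab _ _ (w := c); have := twin_nearest ac _ _ (w := b).
rewrite bc ![_ == a]eq_sym ab' ac' [c == b]eq_sym bc => /(_ isT isT) h1.
by move=> /(_ isT isT); lra.
Qed.

(** An equivalence relation with classes of at most two points, by [twin_unique]. *)
Definition same x y := y = x \/ twin E x y.

Lemma same_refl x : same x x. Proof. by left. Qed.

Lemma same_sym x y : same x y -> same y x.
Proof. by case=> [->|/twin_sym]; [left|right]. Qed.

Lemma same_trans x y z : same x y -> same y z -> same x z.
Proof.
case=> [->//|xy]; case=> [->|yz]; first by right.
by left; exact: twin_unique yz (twin_sym xy).
Qed.

Lemma same_le x x' y : same x x' -> x != y -> E x x' <= E x y.
Proof.
case=> [->|xx'] xy; first by rewrite E0 is_metric_ge0.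
have [->//|yx'] := eqVneq y x'.
by apply/ltW/twin_nearest; rewrite // eq_sym.
Qed.

(** Each endpoint moves by at most [E x y], by [same_le]. *)
Lemma same_dist x x' y y' : x != y -> same x x' -> same y y' ->
  E x' y' <= 3 * E x y.
Proof.
move=> xy /same_le/(_ xy) h1 yy'.
have /(same_le yy') h2 : y != x by rewrite eq_sym.
have := Et x x' y'; have := Et y x y'.
by rewrite (Es x' x); move: h2; rewrite (Es y x); lra.
Qed.

Definition base x := xget x (same x).

Lemma same_base x : same x (base x).
Proof. by apply: xgetI (same_refl x). Qed.

Lemma base_eq x y : same x y -> base x = base y.
Proof.
move=> xy; have sxy : same x = same y.
  apply/funext => z; apply/propext.
  by split; [apply: same_trans; exact: same_sym|exact: same_trans].
rewrite /base sxy; exact: xget_default (same_refl y).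
Qed.

(** A twin pair contained in [A] keeps both points; otherwise the collapse could not be undone on
    [A]. *)
Definition collapse A x :=
  if `[< exists2 y, A y & twin E x y >] then x else base x.

(** The retraction [r] may produce points whose class misses [A]; these go to the base. *)
Definition restore A p :=
  if `[< A p >] then p else xget (base p) (A `&` same p).

Lemma same_collapse A x : same x (collapse A x).
Proof. by rewrite /collapse; case: asboolP => _; [left|exact: same_base]. Qed.

Lemma same_restore A p : same p (restore A p).
Proof.
rewrite /restore; case: asboolP => _; first by left.
by case: xgetP => [x -> []//|_]; exact: same_base.
Qed.

Lemma restore_collapse A a : A a -> restore A (collapse A a) = a.
Proof.
move=> Aa; rewrite /collapse; case: asboolP => [_|nex].
  by rewrite /restore; case: asboolP.
have aba : same a (base a) := same_base a.
rewrite /restore; case: asboolP => [Ab|nAb].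
  by case: aba => // h; case: nex; exists (base a).
apply: xget_unique; first by split => //; exact: same_sym.
move=> y [Ay bay]; have [//|ay] := same_trans aba bay.
by case: nex; exists y.
Qed.

(** The partner of [x] in [B] is within [t], while every point other than [x] is at least [E x y]
    away. *)
Lemma hclose_twin A B t x y : hclose E A B t -> A x -> twin E x y ->
  t < E x y -> B x.
Proof.
move=> [AB _] Ax xy tE; have [z Bz xz] := AB _ Ax.
have [<-//|zx] := eqVneq z x; exfalso.
have : E x y <= E x z by apply: same_le; [right|rewrite eq_sym].
by lra.
Qed.

(** Otherwise the two values are twins more than [t] apart; by [hclose_twin], [A] and [B] then
    contain the same points of this class, and the values agree. *)
Lemma restore_close A B t p : 0 <= t -> hclose E A B t ->
  E (restore A p) (restore B p) <= t.
Proof.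
move=> t0 AB; rewrite leNgt; apply/negP => h.
have neq : restore A p != restore B p.
  by apply/eqP => e; move: h; rewrite e E0; lra.
have tw : twin E (restore A p) (restore B p).
  have [/esym e|//] :=
    same_trans (same_sym (same_restore A p)) (same_restore B p).
  by rewrite e eqxx in neq.
have half X Y z : hclose E X Y t -> X z -> same p z -> Y z.
  move=> XY Xz pz.
  have [e|zt] := same_trans (same_sym (same_restore A p)) pz.
    by subst z; exact: hclose_twin XY Xz tw h.
  have e := twin_unique tw zt; subst z.
  by apply: hclose_twin XY Xz (twin_sym tw) _; rewrite Es.
have BA := hclose_sym Em AB.
move/eqP: neq; apply; rewrite /restore.
have -> : A `&` same p = B `&` same p.
  apply/seteqP; split=> z [? ?]; split=> //.
    exact: half AB _ _.
  exact: half BA _ _.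
have e : A p = B p.
  apply/propext; split=> ?; first by apply: half AB _ _ => //; left.
  by apply: half BA _ _ => //; left.
by rewrite e.
Qed.

(** If [a] and [b] lie in one class, either neither has its twin in its own set and both go to the
    base, or the spacing forces [a = b] and [hclose_twin] puts the twin into both sets. For
    different classes [same_dist] applies. *)
Lemma collapse_close A B t a b : hclose E A B t ->
  spaced E A t -> spaced E B t -> A a -> B b -> E a b <= t ->
  collapse A a = collapse B b \/
  [/\ collapse A a != collapse B b, ~ twin E (collapse A a) (collapse B b)
    & E (collapse A a) (collapse B b) <= 3 * t].
Proof.
move=> AB sA sB Aa Bb ab; have BA := hclose_sym Em AB.
have [->|neq] := eqVneq (collapse A a) (collapse B b); [by left|right].
have nsame : ~ same a b.
  have full X Y x y : hclose E X Y t -> spaced E X t ->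
      spaced E Y t -> X x -> Y y -> same x y -> E x y <= t ->
      (exists2 z, X z & twin E x z) -> collapse X x = collapse Y y.
    move=> XY sX sY Xx Yy xy Exy [z Xz xz].
    have xz' : x != z by case: xz.
    have tz := sX _ _ Xx Xz xz'.
    have e : y = x.
      case: xy => // /(twin_unique xz) e; subst z.
      by move: tz; rewrite ltNge Exy.
    subst y; have Yz : Y z.
      by apply: hclose_twin XY Xz (twin_sym xz) _; rewrite Es.
    rewrite /collapse; case: asboolP => [_|[]]; last by exists z.
    by case: asboolP => // -[]; exists z.
  move=> sab; move/eqP: neq; apply.
  have [fA|nA] := pselect (exists2 z, A z & twin E a z).
    exact: full AB _ _ _ _ _ _ _.
  have [fB|nB] := pselect (exists2 z, B z & twin E b z).
    apply/esym; apply: full BA _ _ _ _ _ _ _; rewrite // 1?Es//.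
    exact: same_sym.
  rewrite /collapse; case: asboolP => // _; case: asboolP => // _.
  exact: base_eq.
split => //.
  move=> tw; apply: nsame.
  apply: same_trans (same_collapse A a) _.
  by apply: same_trans (same_sym (same_collapse B b)); right.
apply: le_trans (_ : 3 * E a b <= _); last lra.
apply: same_dist; [|exact: same_collapse|exact: same_collapse].
by apply/eqP => e; apply: nsame; left.
Qed.

End twin_theory.

(** * The retraction *)

Section retraction.
Variables (R : realType) (T : choiceType) (D E : T -> T -> R).
Hypotheses (Dm : is_metric D) (Em : is_metric E).

Let E0 x : E x x = 0. Proof. by case: Em. Qed.
Let Ep x y : x != y -> 0 < E x y. Proof. by case: Em => _ + _ _; exact. Qed.
Let Es x y : E x y = E y x. Proof. by case: Em. Qed.
Let Et y x z : E x z <= E x y + E y z. Proof. by case: Em => _ _ _; exact. Qed.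

Definition closest (A : set T) u v := [/\ A u, A v, u != v &
  forall x y, A x -> A y -> x != y -> E u v <= E x y].

Definition twinned A := exists2 u, A u & exists2 v, closest A u v & twin E u v.

Definition closest_points A := [set u | exists v, closest A u v].

(** A set, because [xget] needs a default: letting the default run through a nonempty [P] gives a
    singleton depending on [P] alone. *)
Definition chosen (P : set T) : set T :=
  [set w | exists2 u, P u & w = xget u P].

Lemma chosenE (P : set T) u : P u -> chosen P = [set xget u P].
Proof.
move=> Pu; apply/seteqP; split=> [w [u' Pu' ->]|w ->]; last by exists u.
exact: xget_default Pu.
Qed.

Variables (n : nat) (r : set T -> set T) (L K : R).
Hypotheses (n2 : (2 <= n)%N) (K1 : 1 <= K).
Hypothesis r_fun : set_fun (finite_subsets T n) (finite_subsets T n.-1) r.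
Hypothesis r_id : forall A, finite_subsets T n.-1 A -> r A = A.
Hypothesis r_lip : forall A B t, finite_subsets T n A -> finite_subsets T n B ->
  hclose D A B t -> hclose D (r A) (r B) (L * t).
Hypothesis nontwin : forall a b p q, a != b -> ~ twin E a b ->
  D p q <= (L + 1) * D a b -> E p q <= K * E a b.

Let full A := finite_subsets T n A /\ ~ finite_subsets T n.-1 A.

Definition twin_retraction A :=
  if `[< finite_subsets T n.-1 A >] then A
  else if `[< twinned A >] then A `\` chosen (closest_points A)
  else restore E A @` r (collapse E A @` A).

Let s := twin_retraction.

Lemma exists_closest A : full A -> exists u v, closest A u v.
Proof.
move=> [An nA]; have [u0 [v0 [Au0 Av0 uv0]]] := exists_two n2 An nA.
pose P := [set x : T * T | [/\ A x.1, A x.2 & x.1 != x.2]].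
have fP : finite_set P.
  apply: (@sub_finite_set _ _ (A `*` A)); first by move=> x [].
  by apply: finite_setX; exact: finite_subsets_finite An.
have [|[u v] /= [Au Av uv] uvP] := finite_argmin (fun x => E x.1 x.2) fP.
  by exists (u0, v0).
exists u, v; split => // x y Ax Ay xy.
by apply: (uvP (x, y)); split.
Qed.

Lemma exists_chosen A u v : closest A u v ->
  exists2 w, closest_points A w & chosen (closest_points A) = [set w].
Proof.
move=> uv; have Pu : closest_points A u by exists v.
by exists (xget u (closest_points A)); [exact: xgetI Pu|exact: chosenE].
Qed.

Lemma twin_retraction_fun :
  set_fun (finite_subsets T n) (finite_subsets T n.-1) s.
Proof.
move=> A An; rewrite /s /twin_retraction.
case: asboolP => // nA; case: asboolP => [[u Au [v uv _]]|_].
  have [w [w' [Aw Aw' ww' _]] ->] := exists_chosen uv.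
  exact: finite_subsets_setD1 ww'.
by apply: finite_subsets_image; apply: r_fun; exact: finite_subsets_image.
Qed.

(** Deleting a closest point costs the minimal distance. Otherwise [r] fixes the collapsed set
    without [u'], so it moves the collapsed set by at most [(L + 1) * D u' v'], and [nontwin]
    applies to [u'], [v']. Collapsing and restoring cost a factor 3 each. *)
Lemma twin_retraction_near A u v : full A -> A u -> A v -> u != v ->
  hclose E A (s A) (9 * K * E u v).
Proof.
have Kge1 := K1.
move=> [An nA] Au Av uv; have [u1 [v1 c1]] := exists_closest (conj An nA).
have [Au1 Av1 uv1 minE] := c1; have e1 := Ep uv1.
apply: (@hclose_le _ _ _ _ _ (9 * K * E u1 v1)).
  rewrite ler_pM2l; first exact: minE.
  lra.
have KE : E u1 v1 <= K * E u1 v1 by rewrite ler_peMl// ltW.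
rewrite /s /twin_retraction; case: asboolP => // _; case: asboolP => [_|ntw].
  have [w [w' wc] ->] := exists_chosen c1; have [Aw Aw' ww' wmin] := wc.
  apply: hclose_le (hclose_setD1 Em Aw Aw' ww').
  by have := wmin _ _ Au1 Av1 uv1; lra.
set A' := collapse E A @` A; set u' := collapse E A u1.
set v' := collapse E A v1.
have nsame : ~ same E u' v'.
  move=> suv; apply: ntw; exists u1 => //; exists v1 => //.
  have := same_trans Em (same_collapse E A u1) suv.
  move=> /(same_trans Em)/(_ (same_sym Em (same_collapse E A v1))).
  by case=> // e; rewrite e eqxx in uv1.
have uv' : u' != v' by apply/eqP => e; apply: nsame; left.
have A'u : A' u' by exists u1.
have A'v : A' v' by exists v1.
have A'n : finite_subsets T n A' by exact: finite_subsets_image.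
have dA := hclose_setD1 Dm A'u A'v uv'.
have A'1 := finite_subsets_setD1 A'n A'u A'v uv'.
have := r_lip A'n (finite_subsets_le A'1) dA.
rewrite (r_id A'1) => rA; have := hclose_trans Dm dA (hclose_sym Dm rA).
rewrite -[X in X + _]mul1r -mulrDl (addrC 1) => -[AB BA].
have Euv' : E u' v' <= 3 * E u1 v1.
  by apply: same_dist uv1 _ _ => //; exact: same_collapse.
have key a p : A a -> D (collapse E A a) p <= (L + 1) * D u' v' ->
    E a (restore E A p) <= 9 * K * E u1 v1.
  move=> Aa Dap; have [<-|ap] := eqVneq (collapse E A a) p.
    by rewrite restore_collapse// E0; lra.
  have Eap : E (collapse E A a) p <= K * E u' v'.
    by apply: nontwin => // tw; apply: nsame; right.
  have : K * E u' v' <= K * (3 * E u1 v1) by rewrite ler_pM2l//; lra.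
  have : E a (restore E A p) <= 3 * E (collapse E A a) p.
    apply: same_dist => //; last exact: same_restore.
    exact/same_sym/same_collapse.
  by lra.
split=> [a Aa|_ [p rp <-]].
  have [|p rp ap] := AB (collapse E A a); first by exists a.
  by exists (restore E A p); [exists p|exact: key].
have [_ [a Aa <-] ap] := BA _ rp.
by exists a => //; exact: key.
Qed.

(** A pair of [B] no longer than [E u v] has length at least [E u v - 2 * t], so it lies in the
    window of the isolated scale; as mutual nearest neighbours more than [t] apart, its points are
    their own partners in [A]. Conversely, [hclose_twin] puts the closest points of [A] into [B]. *)
Lemma closest_transfer A B t : 0 <= t -> hclose E A B t -> twinned A ->
  spaced E A (4 * t) -> spaced E B (4 * t) ->
  forall x y,
    (closest A x y -> twin E x y) /\ (closest A x y <-> closest B x y).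
Proof.
move=> t0 AB [u Au [v uv tuv]] sA sB; have BA := hclose_sym Em AB.
have [_ Av uv' minA] := uv; have [_ iso] := tuv.
have d4 := sA _ _ Au Av uv'.
have twA x y : closest A x y -> twin E x y.
  move=> [Ax Ay xy minxy]; split => //; suff -> : E x y = E u v by [].
  by apply/eqP; rewrite eq_le minxy// minA.
have inB x y : closest A x y -> B x.
  move=> xy; have [Ax Ay xy' _] := xy.
  apply: (hclose_twin Em AB Ax (twA _ _ xy)).
  by have := sA _ _ Ax Ay xy'; lra.
have cs X x y : closest X x y -> closest X y x.
  move=> [Xx Xy xy h]; split; rewrite 1?eq_sym// => z w Xz Xw zw.
  by rewrite (Es y); exact: h.
have half x y : B x -> B y -> x != y -> E u v <= E x y + 2 * t.
  move=> Bx By xy; have sxy := sB _ _ Bx By xy.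
  have [a Aa ax] := BA.1 _ Bx; have [b Ab yb] := BA.1 _ By.
  have ab : a != b.
    apply/eqP => e; subst b; have := Et a x y; rewrite (Es a y); lra.
  have := minA _ _ Aa Ab ab.
  have := Et x a b; have := Et y x b; rewrite (Es a x); lra.
have inA x y : B x -> B y -> x != y -> E x y <= E u v -> A x.
  move=> Bx By xy le; have sxy := sB _ _ Bx By xy.
  have mn : mutual_nearest E x y.
    by apply: iso => //; have := half _ _ Bx By xy; lra.
  have [a Aa xa] := BA.1 _ Bx.
  have [<-//|ax] := eqVneq a x.
  have ay : a != y by apply/eqP => e; subst a; lra.
  by have [h _] := mn _ ax ay; lra.
move=> x y; split; first exact: twA.
split=> [xy|[Bx By xy minxy]].
  have [Ax Ay xy' minxy] := xy.
  split; [exact: inB xy|exact: inB (cs _ _ _ xy)|by []|].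
  move=> z w Bz Bw zw; rewrite leNgt; apply/negP => lt.
  have zu : E z w <= E u v by have := minxy _ _ Au Av uv'; lra.
  have Az := inA _ _ Bz Bw zw zu.
  have Aw : A w by apply: (inA _ z); rewrite // 1?eq_sym// Es.
  by have := minxy _ _ Az Aw zw; lra.
have le : E x y <= E u v.
  by apply: minxy => //; [exact: inB uv|exact: inB (cs _ _ _ uv)].
have Ax := inA _ _ Bx By xy le.
have Ay : A y by apply: (inA _ x); rewrite // 1?eq_sym// Es.
split=> // z w Az Aw zw; apply: le_trans le _; exact: minA.
Qed.

Lemma twinned_transfer A B t : 0 <= t -> hclose E A B t ->
  spaced E A (4 * t) -> spaced E B (4 * t) -> twinned A -> twinned B.
Proof.
move=> t0 AB sA sB tA; have h := closest_transfer t0 AB tA sA sB.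
case: tA => u _ [v uv tuv]; have [_ [/(_ uv) uvB _]] := h u v.
by exists u; [case: uvB|exists v].
Qed.

Lemma twin_retraction_spaced A B t : full A -> full B -> 0 <= t ->
  hclose E A B t -> spaced E A (4 * t) -> spaced E B (4 * t) ->
  hclose E (s A) (s B) (9 * K * t).
Proof.
have Kge1 := K1.
move=> [An nA] [Bn nB] t0 AB sA sB; have BA := hclose_sym Em AB.
have Kt : t <= K * t by rewrite ler_peMl.
rewrite /s /twin_retraction; case: asboolP => // _.
case: (asboolP (finite_subsets T n.-1 B)) => // _.
case: asboolP => [tA|nA']; case: asboolP => [tB|nB'].
- have h := closest_transfer t0 AB tA sA sB.
  have [u Au [v uv _]] := tA.
  have eP : closest_points A = closest_points B.
    by apply/seteqP; split=> x [y /(h x y).2 xy]; exists y.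
  rewrite -eP; have [w [w' ww'] ->] := exists_chosen uv.
  have [/(_ ww') tw [/(_ ww') ww'B _]] := h w w'.
  (* The deleted [w] is never the partner of [x]: its nearest other point [w'] is already more than
     [4 * t] away. *)
  have key X Y : hclose E X Y t -> spaced E X (4 * t) -> closest X w w' ->
      forall x, (X `\ w) x -> exists2 y, (Y `\ w) y & E x y <= 9 * K * t.
    move=> XY sX [Xw Xw' neq _] x [Xx xw].
    have [y Yy xy] := XY.1 _ Xx; exists y; last by lra.
    split=> // yw; rewrite {}yw in xy.
    have wx : w != x by apply/eqP => e; apply: xw.
    have : E w w' <= E w x by apply: same_le => //; right.
    by have := sX _ _ Xw Xw' neq; rewrite (Es w x); lra.
  split; first exact: key AB sA ww'.
  move=> b /(key _ _ BA sB ww'B)[a Aa ba]; exists a => //.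
  by rewrite Es.
- by case: nB'; exact: twinned_transfer AB sA sB tA.
- by case: nA'; exact: twinned_transfer BA sB sA tB.
have sp X : spaced E X (4 * t) -> spaced E X t.
  by move=> sX x y Xx Xy xy; have := sX _ _ Xx Xy xy; lra.
set cA := collapse E A; set cB := collapse E B.
have A'n : finite_subsets T n (cA @` A) by exact: finite_subsets_image.
have B'n : finite_subsets T n (cB @` B) by exact: finite_subsets_image.
(* the D-distance between the collapsed sets is attained at a matched pair,
   which collapse_close shows not to be a twin pair *)
pose P := [set x : T * T | [/\ A x.1, B x.2 & E x.1 x.2 <= t]].
have fP : finite_set P.
  apply: (@sub_finite_set _ _ (A `*` B)); first by move=> x [].
  by apply: finite_setX; [exact: finite_subsets_finite An|
    exact: finite_subsets_finite Bn].
have P0 : P !=set0.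
  have [[a Aa] _] := An; have [b Bb ab] := AB.1 _ Aa.
  by exists (a, b); split.
have [[a0 b0] /= [Aa0 Bb0 ab0] max] := finite_argmax
  (fun x => D (cA x.1) (cB x.2)) fP P0.
have D'AB : hclose D (cA @` A) (cB @` B) (D (cA a0) (cB b0)).
  split=> [_ [a Aa <-]|_ [b Bb <-]].
    have [b Bb ab] := AB.1 _ Aa; exists (cB b); first by exists b.
    by apply: (max (a, b)); split.
  have [a Aa ab] := AB.2 _ Bb; exists (cA a); first by exists a.
  by apply: (max (a, b)); split.
(* If the collapses of [a0] and [b0] coincide, the bound is 0 and [p = q]; otherwise they are not
   twins and [nontwin] applies. *)
have close p q : D p q <= L * D (cA a0) (cB b0) -> p = q \/ E p q <= 3 * K * t.
  move=> Dpq; have [e|] := collapse_close Em AB (sp _ sA) (sp _ sB) Aa0 Bb0 ab0.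
    left; apply/eqP/negPn/negP => pq; have [d0 dp _ _] := Dm.
    by have := dp _ _ pq; move: Dpq; rewrite /cA e d0 mulr0; lra.
  move=> [neq ntw Eab]; right.
  have Dge := is_metric_ge0 (cA a0) (cB b0) Dm.
  have : E p q <= K * E (cA a0) (cB b0) by apply: nontwin => //; lra.
  have : K * E (cA a0) (cB b0) <= K * (3 * t) by rewrite ler_pM2l//; lra.
  by lra.
have key p q : D p q <= L * D (cA a0) (cB b0) ->
    E (restore E A p) (restore E B q) <= 9 * K * t.
  move=> Dpq; have [<-|pq] := eqVneq p q.
    by have := restore_close Em p t0 AB; lra.
  have [e|Epq] := close _ _ Dpq; first by rewrite e eqxx in pq.
  have : E (restore E A p) (restore E B q) <= 3 * E p q.
    by apply: same_dist => //; exact: same_restore.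
  by lra.
have [rAB rBA] := r_lip A'n B'n D'AB.
split=> [_ [p rp <-]|_ [q rq <-]].
  have [q rq pq] := rAB _ rp.
  by exists (restore E B q); [exists q|exact: key].
have [p rp pq] := rBA _ rq.
by exists (restore E A p); [exists p|exact: key].
Qed.

Lemma twin_retractionP : lret E n s.
Proof.
split; first exact: twin_retraction_fun; last first.
  by move=> A An; rewrite /s /twin_retraction; case: asboolP.
have Kge1 := K1.
(* Moving each of two sets that are not [6 * t]-spaced costs [9 * 6 = 54] times [K * t], passing
   between them costs [t], and well spaced sets need [9 * K]. *)
exists (1 + 117 * K); first lra.
move=> A B t An Bn AB; have BA := hclose_sym Em AB.
have t0 : 0 <= t.
  have [[a Aa] _] := An; have [b Bb ab] := AB.1 _ Aa.
  exact: le_trans (is_metric_ge0 a b Em) ab.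
have Kt : t <= K * t by rewrite ler_peMl.
(* Of the spacing [6 * t], the passage to the other set loses [2 * t]. *)
have spaced_pair X Y : finite_subsets T n X -> finite_subsets T n Y ->
    hclose E X Y t -> ~ finite_subsets T n.-1 X -> spaced E X (6 * t) ->
    [/\ full X, full Y, spaced E X (4 * t) & spaced E Y (4 * t)].
  move=> Xn Yn XY nX sX.
  have sX4 : spaced E X (4 * t + 2 * t).
    by move=> x y Xx Xy xy; have := sX _ _ Xx Xy xy; lra.
  have [|nY sY] := hclose_spaced Em Xn nX Yn XY sX4; first lra.
  by split => // x y Xx Xy xy; have := sX _ _ Xx Xy xy; lra.
have move_le X : finite_subsets T n X ->
    ~ (~ finite_subsets T n.-1 X /\ spaced E X (6 * t)) ->
    hclose E X (s X) (54 * K * t).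
  move=> Xn nX; have [X1|X1] := pselect (finite_subsets T n.-1 X).
    rewrite /s /twin_retraction; case: asboolP => // _.
    by apply: hclose_le (hclose_refl X Em); lra.
  have [u [v [Xu Xv uv le]]] :
      exists u v, [/\ X u, X v, u != v & E u v <= 6 * t].
    apply: contrapT => nuv; apply: nX; split=> // x y Xx Xy xy.
    by rewrite ltNge; apply/negP => le; apply: nuv; exists x, y.
  apply: hclose_le (twin_retraction_near (conj Xn X1) Xu Xv uv).
  have : K * E u v <= K * (6 * t) by rewrite ler_pM2l//; lra.
  by lra.
have [[nA sA]|mA] :=
    pselect (~ finite_subsets T n.-1 A /\ spaced E A (6 * t)).
  have [fA fB sA4 sB4] := spaced_pair _ _ An Bn AB nA sA.
  by apply: hclose_le (twin_retraction_spaced fA fB t0 AB sA4 sB4); lra.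
have [[nB sB]|mB] :=
    pselect (~ finite_subsets T n.-1 B /\ spaced E B (6 * t)).
  have [fB fA sB4 sA4] := spaced_pair _ _ Bn An BA nB sB.
  by apply: hclose_le (twin_retraction_spaced fA fB t0 AB sA4 sB4); lra.
have := hclose_trans Em (hclose_sym Em (move_le _ An mA))
  (hclose_trans Em AB (move_le _ Bn mB)).
by apply: hclose_le; lra.
Qed.

End retraction.

(** * Quasihomogeneous maps *)

(** A continuous injection of the half-line is monotone, and [eta] cannot decrease because it takes
    the value [eta 0 + 1]. *)
Lemma half_line_homeomorphism (R : realType) (eta : R -> R) :
  homeomorphism (`[0, +oo[ : set R) (`[0, +oo[ : set R) eta ->
  [/\ forall x, 0 <= x -> 0 <= eta x,
      forall x y, 0 <= x -> 0 <= y -> (eta x <= eta y) = (x <= y) &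
      exists2 m, 0 < m & eta m = 1 / 2].
Proof.
move=> [h [[fun_eta fun_h etaK hK] [cont_eta _]]].
have eta0 x : 0 <= x -> 0 <= eta x.
  by have := fun_eta x; rewrite /= !in_itv/= !andbT.
have h0 x : 0 <= x -> 0 <= h x.
  by have := fun_h x; rewrite /= !in_itv/= !andbT.
have inI (x : R) : 0 <= x -> x \in (`[0, +oo[ : interval R).
  by rewrite in_itv/= andbT.
have inS (x : R) : 0 <= x -> x \in (`[0, +oo[%classic : set R).
  by move=> x0; rewrite mem_set//=; exact: inI.
have hE x : 0 <= x -> eta (h x) = x by move=> /inS; exact: hK.
have inj_eta : {in (`[0, +oo[ : interval R) &, injective eta}.
  move=> x y; rewrite !in_itv/= !andbT => x0 y0 e.
  by rewrite -(etaK x (inS _ x0)) -(etaK y (inS _ y0)) e.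
have mono x y : 0 <= x -> 0 <= y -> (eta x <= eta y) = (x <= y).
  move=> x0 y0; have [/le_mono_in up|/le_nmono_in down] :=
    itv_continuous_inj_mono cont_eta inj_eta.
    by apply: up; exact: inI.
  have e1 : 0 <= eta 0 + 1 by rewrite addr_ge0// eta0.
  have := down _ _ (inI _ (h0 _ e1)) (inI _ (lexx 0)).
  by rewrite (hE _ e1) h0// => /idP; lra.
split=> //; have half0 : 0 <= 1 / 2 :> R by lra.
exists (h (1 / 2)); last exact: hE.
(* [h (1 / 2) = 0] would give [eta 0 = 1 / 2], although [eta 0] is the least value and 0 is a
   value. *)
rewrite lt_neqAle h0// andbT; apply/eqP => e.
have : eta 0 <= eta (h 0) by rewrite mono// h0.
by rewrite (hE 0 (lexx _)) {1}e hE//; lra.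
Qed.

(** * The Hausdorff distance of finite sets in terms of matchings *)

Section hausdorff.
Variables (R : realType) (X : metricType R).

Lemma is_metric_mdist : is_metric (@mdist R X).
Proof.
split; [exact: mdistxx|by move=> x y; rewrite mdist_gt0|exact: metric_sym|].
exact: metric_triangle.
Qed.

(** The infimum over a nonempty finite set is attained. *)
Lemma dist_to_set_le (x : X) (A : set X) (t : R) :
  finite_set A -> A !=set0 ->
  dist_to_set x A <= t <-> exists2 a, A a & mdist x a <= t.
Proof.
move=> fA A0; have [a Aa amin] := finite_argmin (mdist x) fA A0.
have lb : lbound [set mdist x a | a in A] (mdist x a).
  by move=> _ [b Ab <-]; exact: amin.
split=> [|[b Ab le]].
  move=> le; exists a => //; apply: le_trans le.
  by apply: lb_le_inf => //; exists (mdist x a), a.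
by apply: le_trans le; apply: ge_inf; [exists (mdist x a)|exists b].
Qed.

Lemma sup_finite_image_le (A : set X) (h : X -> R) (t : R) :
  finite_set A -> A !=set0 ->
  sup [set h a | a in A] <= t <-> forall a, A a -> h a <= t.
Proof.
move=> fA A0; have [a Aa amax] := finite_argmax h fA A0.
split=> [le b Ab|le].
  apply: le_trans le; apply: ub_le_sup; last by exists b.
  by exists (h a) => _ [c Ac <-]; exact: amax.
by apply: ge_sup; [exists (h a), a|move=> _ [c Ac <-]; exact: le].
Qed.

Lemma hausdorff_dist_le n (A B : set X) (t : R) :
  finite_subsets X n A -> finite_subsets X n B ->
  hausdorff_dist A B <= t <-> hclose mdist A B t.
Proof.
move=> An Bn; have fA := finite_subsets_finite An.
have fB := finite_subsets_finite Bn; case: An Bn => [A0 _] [B0 _].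
rewrite /hausdorff_dist ge_max; split.
  move=> /andP[/sup_finite_image_le AB /sup_finite_image_le BA]; split.
    by move=> a /(AB fA A0)/dist_to_set_le; exact.
  move=> b /(BA fB B0)/(dist_to_set_le _ _ fA A0)[a Aa ba].
  by exists a; rewrite // metric_sym.
move=> [AB BA]; apply/andP; split; apply/sup_finite_image_le => //.
  by move=> a /AB; apply dist_to_set_le.
move=> b /BA[a Aa ab]; apply/dist_to_set_le => //.
by exists a; rewrite // metric_sym.
Qed.

Lemma lret_lipschitz n (r : set X -> set X) :
  lret mdist n r <-> lipschitz_retraction n r.
Proof.
split=> -[r_fun [L L0 r_lip] r_id]; split=> //.
  exists L => [|A B An Bn]; first exact: le_trans L0.
  have rle C (Cn : finite_subsets X n C) := finite_subsets_le (r_fun _ Cn).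
  apply/(hausdorff_dist_le _ (rle _ An) (rle _ Bn))/r_lip => //.
  exact/(hausdorff_dist_le _ An Bn).
exists (1 + L) => [|A B t An Bn AB]; first by rewrite lerDl.
have rle C (Cn : finite_subsets X n C) := finite_subsets_le (r_fun _ Cn).
have t0 : 0 <= t.
  have [[a Aa] _] := An; have [b Bb ab] := AB.1 _ Aa.
  exact: le_trans (is_metric_ge0 a b is_metric_mdist) ab.
apply/(hausdorff_dist_le _ (rle _ An) (rle _ Bn)).
apply: le_trans (r_lip _ _ An Bn) _.
have /(hausdorff_dist_le _ An Bn) AB' := AB.
have : L * hausdorff_dist A B <= L * t by exact: ler_wpM2l.
by lra.
Qed.

End hausdorff.

Lemma lret_transport (R : realType) (T U : choiceType) (d : T -> T -> R)
    (n : nat) (r : set T -> set T) (f : T -> U) (g : U -> T) :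
  cancel f g -> cancel g f -> lret d n r ->
  lret (fun y z => d (g y) (g z)) n (fun B => f @` r (g @` B)).
Proof.
move=> fK gK [r_fun [L L1 r_lip] r_id]; split.
- by move=> B /(finite_subsets_image g)/r_fun/(finite_subsets_image f).
- exists L => // A B t An Bn AB.
  have gAB : hclose d (g @` A) (g @` B) t.
    split=> [_ [a /AB.1[b Bb ab] <-]|_ [b /AB.2[a Aa ab] <-]].
      by exists (g b); [exists b|].
    by exists (g a); [exists a|].
  have [AB' BA'] := r_lip _ _ _ (finite_subsets_image g An)
    (finite_subsets_image g Bn) gAB.
  split=> [_ [x /AB'[y ry xy] <-]|_ [y /BA'[x rx xy] <-]].
    by exists (f y); [exists y|rewrite !fK].
  by exists (f x); [exists x|rewrite !fK].
move=> B Bn; rewrite r_id; last exact: finite_subsets_image.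
by rewrite image_comp (_ : f \o g = id) ?image_id//; exact/funext.
Qed.

Theorem proposition6p6 (R : realType) (X Y : metricType R) (f : X -> Y)
    (qf : quasihomogeneous f) (lcpX : lipschitz_clustering X) :
  lipschitz_clustering Y.
Proof.
have [[g [[_ _ fK0 gK0] _]] [eta /half_line_homeomorphism]] := qf.
move=> [eta0 mono_eta [m m0 eta_m]] f_eta n n2.
have fK : cancel f g by move=> x; apply: fK0; exact: mem_set.
have gK : cancel g f by move=> y; apply: gK0; exact: mem_set.
have [r /lret_lipschitz/(lret_transport fK gK)] := lcpX n n2.
set D := (fun y z : Y => mdist (g y) (g z)) => -[r_fun [L L1 r_lip] r_id].
have Em := is_metric_mdist Y.
have Dm : is_metric D.
  have [d0 dp ds dt] := is_metric_mdist X.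
  split=> [x|x y xy|x y|x y z]; [exact: d0| |exact: ds|exact: dt].
  by apply: dp; rewrite (can_eq gK).
have ratio x1 x2 x3 x4 : uniq [:: x1; x2; x3; x4] ->
    [/\ 0 < D x3 x4, 0 < mdist x3 x4, 0 <= D x1 x2 / D x3 x4 &
     mdist x1 x2 / mdist x3 x4 <= eta (D x1 x2 / D x3 x4)].
  move=> u; have x34 : x3 != x4.
    by move: u; rewrite /= !inE !andbT => /and3P[].
  have [_ Dp _ _] := Dm; have [_ Ep _ _] := Em.
  split; [exact: Dp|exact: Ep|by apply: divr_ge0; exact: is_metric_ge0|].
  have := f_eta (g x1) (g x2) (g x3) (g x4); rewrite !gK; apply.
  by rewrite -[[:: g x1; _; _; _]]/(map g [:: x1; x2; x3; x4]) map_inj_uniq//;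
     exact: can_inj gK.
have E_of_D M : 0 <= M -> exists2 K, 0 < K & forall x1 x2 x3 x4,
    uniq [:: x1; x2; x3; x4] -> D x1 x2 <= M * D x3 x4 ->
    mdist x1 x2 <= K * mdist x3 x4 :> R.
  (* The summand 1 keeps the constant positive even if [eta M] is 0. *)
  move=> M0; exists (1 + eta M) => [|x1 x2 x3 x4 /ratio[D34 E34 q0 le] D12].
    by have := eta0 _ M0; lra.
  have : eta (D x1 x2 / D x3 x4) <= eta M by rewrite mono_eta// ler_pdivrMr.
  by move=> /(le_trans le); rewrite ler_pdivrMr//; lra.
have D_of_E : exists2 C, 0 < C & forall x1 x2 x3 x4,
    uniq [:: x1; x2; x3; x4] -> mdist x3 x4 <= 2 * mdist x1 x2 :> R ->
    D x3 x4 <= C * D x1 x2.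
  (* The ratio of E-distances is at least [1 / 2 = eta m], so by monotonicity the ratio of
     D-distances is at least [m]. *)
  exists m^-1 => [|x1 x2 x3 x4 /ratio[D34 E34 q0 le] E12].
    by rewrite invr_gt0.
  rewrite ler_pdivlMl// -ler_pdivlMr// -mono_eta//; last exact: ltW.
  by apply: le_trans le; rewrite eta_m ler_pdivlMr//; lra.
have [|K K1 nontwin] := nontwin_comparable Em Dm E_of_D D_of_E (L := L + 1).
  by lra.
exists (twin_retraction mdist n (fun B => f @` r (g @` B))).
by apply/lret_lipschitz; exact: (@twin_retractionP _ _ D _ _ _ _ _ L K).
Qed.
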